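(* Let $\Gamma$ be a context, $\sigma$ a type, and $t,u$ classical QML terms with $\Gamma\vdash t:\sigma$ and $\Gamma\vdash u:\sigma$. If the functions $[\![\Gamma\vdash t:\sigma]\!]$ and $[\![\Gamma\vdash u:\sigma]\!]$ from $[\![\Gamma]\!]$ to $[\![\sigma]\!]$ are extensionally equal, then $\Gamma\vdash t\equiv u:\sigma$ is derivable in the classical equational theory.
   Context: **Syntax.** Types: $\sigma::=\mathcal Q_1\mid\mathcal Q_2\mid\sigma\otimes\tau$. Patterns: $p::=x\mid(x,y)$. Classical terms: $t,u,e::=x\mid()\mid(t,u)\mid\mathbf{let}\ p=t\ \mathbf{in}\ u\mid\mathbf{if}^\circ\ t\ \mathbf{then}\ u\ \mathbf{else}\ u'\mid\mathrm{false}\mid\mathrm{true}$. Contexts: $\Gamma::=\bullet\mid\Gamma,x:\sigma$, each variable occurring at most once (finite functions from variables to types). The partial operation $\Gamma\otimes\Delta$ merges two contexts, identifying shared variables; it is defined only if shared variables have the same type in both: $(\Gamma,x:\sigma)\otimes(\Delta,x:\sigma)=(\Gamma\otimes\Delta),x:\sigma$; $(\Gamma,x:\sigma)\otimes\Delta=(\Gamma\otimes\Delta),x:\sigma$ if $x\notin\mathrm{dom}(\Delta)$; $\bullet\otimes\Delta=\Delta$. Whenever $\otimes$ is used it is assumed defined. **Typing rules** for $\Gamma\vdash t:\sigma$ (strict: every variable must be used, except those of type $\mathcal Q_1$): - (var) $x:\sigma\vdash x:\sigma$; (unit) $\bullet\vdash():\mathcal Q_1$; $\bullet\vdash\mathrm{false}:\mathcal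 Q_2$; $\bullet\vdash\mathrm{true}:\mathcal Q_2$. - (let) from $\Gamma\vdash t:\sigma$ and $\Delta,x:\sigma\vdash u:\tau$ infer $\Gamma\otimes\Delta\vdash\mathbf{let}\ x=t\ \mathbf{in}\ u:\tau$. - ($\otimes$-intro) from $\Gamma\vdash t:\sigma$ and $\Delta\vdash u:\tau$ infer $\Gamma\otimes\Delta\vdash(t,u):\sigma\otimes\tau$. - ($\otimes$-elim) from $\Gamma\vdash t:\sigma\otimes\tau$ and $\Delta,x:\sigma,y:\tau\vdash u:\rho$ infer $\Gamma\otimes\Delta\vdash\mathbf{let}\ (x,y)=t\ \mathbf{in}\ u:\rho$. - ($\mathbf{if}^\circ$) from $\Gamma\vdash c:\mathcal Q_2$ and $\Delta\vdash t,u:\sigma$ infer $\Gamma\otimes\Delta\vdash\mathbf{if}^\circ\ c\ \mathbf{then}\ t\ \mathbf{else}\ u:\sigma$. - (wk-unit) from $\Gamma,x:\mathcal Q_1\vdash t:\sigma$ infer $\Gamma\vdash t:\sigma$, and conversely bindings of variables of type $\mathcal Q_1$ may be added to the context. **Semantics.** $[\![\mathcal Q_1]\!]=\{0\}$, $[\![\mathcal Q_2]\!]=\{0,1\}$, $[\![\sigma\otimes\tau]\!]=[\![\sigma]\!]\times[\![\tau]\!]$. $|\bullet|=\mathcal Q_1$, $|\Gamma,x:\sigma|=|\Gamma|\otimes\sigma$, and $[\![\Gamma]\!]=[\![\,|\Gamma|\,]\!]$ (environments). For $g\in[\![\Gamma\otimes\Delta]\!]$ let $(g_\Gamma,g_\Delta)=\delta_{\Gamma,\Delta}(g)\in[\![\Gamma]\!]\times[\![\Delta]\!]$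 be its two restrictions (values of shared variables are copied). The function $[\![\Gamma\vdash t:\sigma]\!]:[\![\Gamma]\!]\to[\![\sigma]\!]$ is defined by induction on the derivation: $[\![()]\!]0=0$; $[\![\mathrm{false}]\!]0=0$; $[\![\mathrm{true}]\!]0=1$; $[\![x:\sigma\vdash x:\sigma]\!](0,a)=a$; $[\![\mathbf{let}\ x=t\ \mathbf{in}\ u]\!]g=[\![u]\!](g_\Delta,[\![t]\!]g_\Gamma)$; $[\![(t,u)]\!]g=([\![t]\!]g_\Gamma,[\![u]\!]g_\Delta)$; $[\![\mathbf{let}\ (x,y)=t\ \mathbf{in}\ u]\!]g=[\![u]\!]((g_\Delta,a),b)$ where $(a,b)=[\![t]\!]g_\Gamma$; $[\![\mathbf{if}^\circ\ c\ \mathbf{then}\ t\ \mathbf{else}\ u]\!]g$ is $[\![t]\!]g_\Delta$ if $[\![c]\!]g_\Gamma=1$ and $[\![u]\!]g_\Delta$ if $[\![c]\!]g_\Gamma=0$; for wk-unit, $[\![\Gamma\vdash t]\!]g=[\![\Gamma,x:\mathcal Q_1\vdash t]\!](g,0)$. **Classical equations.** Values: $val::=x\mid()\mid\mathrm{false}\mid\mathrm{true}\mid(val_1,val_2)$. - $\mathbf{let}\ p=val\ \mathbf{in}\ u\equiv u[val/p]$. - $\mathbf{let}\ (x,y)=(t,u)\ \mathbf{in}\ e\equiv\mathbf{let}\ x=t\ \mathbf{in}\ \mathbf{let}\ y=u\ \mathbf{in}\ e$; $\mathbf{if}^\circ\ \mathrm{false}\ \mathbf{then}\ t\ \mathbf{else}\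 u\equiv u$; $\mathbf{if}^\circ\ \mathrm{true}\ \mathbf{then}\ t\ \mathbf{else}\ u\equiv t$. - $()\equiv t$ if $t:\mathcal Q_1$; $\mathbf{let}\ x=t\ \mathbf{in}\ x\equiv t$; $\mathbf{let}\ (x,y)=t\ \mathbf{in}\ (x,y)\equiv t$; $\mathbf{if}^\circ\ t\ \mathbf{then}\ \mathrm{true}\ \mathbf{else}\ \mathrm{false}\equiv t$. - $\mathbf{let}\ p=t\ \mathbf{in}\ \mathbf{let}\ q=u\ \mathbf{in}\ e\equiv\mathbf{let}\ q=u\ \mathbf{in}\ \mathbf{let}\ p=t\ \mathbf{in}\ e$; $\mathbf{let}\ p=(\mathbf{if}^\circ\ t\ \mathbf{then}\ u_0\ \mathbf{else}\ u_1)\ \mathbf{in}\ e\equiv\mathbf{if}^\circ\ t\ \mathbf{then}\ (\mathbf{let}\ p=u_0\ \mathbf{in}\ e)\ \mathbf{else}\ (\mathbf{let}\ p=u_1\ \mathbf{in}\ e)$. $\Gamma\vdash t\equiv u:\sigma$ means that $\Gamma\vdash t:\sigma$, $\Gamma\vdash u:\sigma$, and $t\equiv u$ is derivable at type $\sigma$ from these equations by equational reasoning (equivalence and congruence), with the usual conventions avoiding variable capture.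
   Formalization: The equation let p = val in u ≡ u[val/p], undefined when p = (x,y) and val is a variable z, is read there as let (x,y) = z in e[(x,y)/w] ≡ e[z/w]; if restricted to values matching the pattern, the claim is false. *)

(* Defs.v *)
From mathcomp Require Import all_boot.

Set Implicit Arguments.
Unset Strict Implicit.
Unset Printing Implicit Defensive.

Inductive ty : Type := Q1 | Q2 | Tens of ty & ty.

(* Terms are in de Bruijn form.  Binders are the patterns of [Let p t u], which
   bind in [u] only:
   - [Let PVar t u]  is  let x = t in u,      with x = Var 0 in u;
   - [Let PPair t u] is  let (x, y) = t in u, with y = Var 0, x = Var 1 in u. *)
Inductive pat : Type := PVar | PPair.

Definition arity (p : pat) : nat := if p is PVar then 1 else 2.

Inductive term : Type :=
| Var of nat
| Unit
| Pair of term & term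
| Let of pat & term & term
| If of term & term & term
| Ff
| Tt.

Inductive value : term -> Prop :=
| value_var i : value (Var i)
| value_unit : value Unit
| value_ff : value Ff
| value_tt : value Tt
| value_pair v w : value v -> value w -> value (Pair v w).

Definition upr (r : nat -> nat) : nat -> nat :=
  fun i => if i is j.+1 then (r j).+1 else 0.

Fixpoint rename (r : nat -> nat) (t : term) : term :=
  match t with
  | Var i => Var (r i)
  | Unit => Unit
  | Pair t u => Pair (rename r t) (rename r u)
  | Let p t u => Let p (rename r t) (rename (iter (arity p) upr r) u)
  | If c t u => If (rename r c) (rename r t) (rename r u)
  | Ff => Ff
  | Tt => Tt
  end.

Definition shift (k : nat) : term -> term := rename (addn k).

Definition ups (s : nat -> term) : nat -> term :=
  fun i => if i is j.+1 then shift 1 (s j) else Var 0.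

Fixpoint subst (s : nat -> term) (t : term) : term :=
  match t with
  | Var i => s i
  | Unit => Unit
  | Pair t u => Pair (subst s t) (subst s u)
  | Let p t u => Let p (subst s t) (subst (iter (arity p) ups s) u)
  | If c t u => If (subst s c) (subst s t) (subst s u)
  | Ff => Ff
  | Tt => Tt
  end.

(* u[v/x] and u[v/x, w/y], for the bound variables of the two patterns. *)
Definition subst1 (v u : term) : term :=
  subst (fun i => if i is j.+1 then Var j else v) u.

Definition subst2 (v w u : term) : term :=
  subst (fun i => match i with 0 => w | 1 => v | j.+2 => Var j end) u.

(* For e with a distinguished variable z = Var 0, the term e[(x, y)/z], where
   x and y are the variables bound by an enclosing pair pattern. *)
Definition fold_pair (e : term) : term :=
  subst (fun i => if i is j.+1 then Var j.+2 else Pair (Var 1) (Var 0)) e.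

(* Exchanges the innermost block of m variables with the next block of n. *)
Definition swap_blocks (m n : nat) : term -> term :=
  rename (fun i => if i < m then i + n else if i < m + n then i - m else i).

(* A context lists the names in scope, the most recent first; [None] marks a
   name outside the domain.  It is thus a finite partial function from
   variables to types, and the name of a variable is its position. *)
Definition ctx : Type := seq (option ty).

(* [single G x s] : G is the context x : s. *)
Inductive single : ctx -> nat -> ty -> Type :=
| single_here k s : single (Some s :: nseq k None) 0 s
| single_there G x s : single G x s -> single (None :: G) x.+1 s.

(* [merge G D T] : the context G (x) D is defined and equal to T. *)
Inductive merge : ctx -> ctx -> ctx -> Type :=
| merge_nil : merge [::] [::] [::]
| merge_none G D T : merge G D T -> merge (None :: G) (None :: D) (None :: T)
| merge_both s G D T :
    merge G D T -> merge (Some s :: G) (Some s :: D) (Some s :: T)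
| merge_left s G D T :
    merge G D T -> merge (Some s :: G) (None :: D) (Some s :: T)
| merge_right s G D T :
    merge G D T -> merge (None :: G) (Some s :: D) (Some s :: T).

(* Derivations live in [Type], as the semantics is defined by recursion on
   them.  [ty_unwk] and [ty_wk] are the two directions of wk-unit; the variable
   may be any entry of the context, since contexts are unordered. *)
Inductive typing : ctx -> term -> ty -> Type :=
| ty_var G x s : single G x s -> typing G (Var x) s
| ty_unit k : typing (nseq k None) Unit Q1
| ty_ff k : typing (nseq k None) Ff Q2
| ty_tt k : typing (nseq k None) Tt Q2
| ty_let G D T s s' t u :
    merge G D T -> typing G t s -> typing (Some s :: D) u s' ->
    typing T (Let PVar t u) s'
| ty_pair G D T s s' t u :
    merge G D T -> typing G t s -> typing D u s' ->
    typing T (Pair t u) (Tens s s')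
| ty_letpair G D T s s' r t u :
    merge G D T -> typing G t (Tens s s') ->
    typing (Some s' :: Some s :: D) u r ->
    typing T (Let PPair t u) r
| ty_if G D T s c t u :
    merge G D T -> typing G c Q2 -> typing D t s -> typing D u s ->
    typing T (If c t u) s
| ty_unwk G1 G2 t s :
    typing (G1 ++ Some Q1 :: G2) t s -> typing (G1 ++ None :: G2) t s
| ty_wk G1 G2 t s :
    typing (G1 ++ None :: G2) t s -> typing (G1 ++ Some Q1 :: G2) t s.

(* 0, 1 in the interpretation of Q2 are the booleans false, true. *)
Fixpoint ty_sem (s : ty) : Type :=
  match s with
  | Q1 => unit
  | Q2 => bool
  | Tens s s' => (ty_sem s * ty_sem s')%type
  end.

Fixpoint ctx_ty (G : ctx) : ty :=
  match G with
  | [::] => Q1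
  | Some s :: G => Tens (ctx_ty G) s
  | None :: G => ctx_ty G
  end.

Definition env (G : ctx) : Type := ty_sem (ctx_ty G).

Fixpoint lookup G x s (h : single G x s) : env G -> ty_sem s :=
  match h in single G x s return env G -> ty_sem s with
  | single_here _ _ => fun g => g.2
  | single_there _ _ _ h => fun g => lookup h g
  end.

Fixpoint delta G D T (h : merge G D T) : env T -> env G * env D :=
  match h in merge G D T return env T -> env G * env D with
  | merge_nil => fun g => (g, g)
  | merge_none _ _ _ h => fun g => delta h g
  | merge_both _ _ _ _ h => fun g =>
      let: (gG, gD) := delta h g.1 in ((gG, g.2), (gD, g.2))
  | merge_left _ _ _ _ h => fun g =>
      let: (gG, gD) := delta h g.1 in ((gG, g.2), gD)
  | merge_right _ _ _ _ h => fun g =>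
      let: (gG, gD) := delta h g.1 in (gG, (gD, g.2))
  end.

Fixpoint add_unit (G1 G2 : ctx) :
    env (G1 ++ None :: G2) -> env (G1 ++ Some Q1 :: G2) :=
  match G1 return env (G1 ++ None :: G2) -> env (G1 ++ Some Q1 :: G2) with
  | [::] => fun g => (g, tt)
  | Some _ :: G1 => fun g => (add_unit g.1, g.2)
  | None :: G1 => fun g => @add_unit G1 G2 g
  end.

Fixpoint drop_unit (G1 G2 : ctx) :
    env (G1 ++ Some Q1 :: G2) -> env (G1 ++ None :: G2) :=
  match G1 return env (G1 ++ Some Q1 :: G2) -> env (G1 ++ None :: G2) with
  | [::] => fun g => g.1
  | Some _ :: G1 => fun g => (drop_unit g.1, g.2)
  | None :: G1 => fun g => @drop_unit G1 G2 g
  end.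

Fixpoint sem G t s (d : typing G t s) : env G -> ty_sem s :=
  match d in typing G t s return env G -> ty_sem s with
  | ty_var _ _ _ h => fun g => lookup h g
  | ty_unit _ => fun _ => tt
  | ty_ff _ => fun _ => false
  | ty_tt _ => fun _ => true
  | ty_let _ _ _ _ _ _ _ h dt du => fun g =>
      let: (gG, gD) := delta h g in sem du (gD, sem dt gG)
  | ty_pair _ _ _ _ _ _ _ h dt du => fun g =>
      let: (gG, gD) := delta h g in (sem dt gG, sem du gD)
  | ty_letpair _ _ _ _ _ _ _ _ h dt du => fun g =>
      let: (gG, gD) := delta h g in
      let: (a, b) := sem dt gG in sem du ((gD, a), b)
  | ty_if _ _ _ _ _ _ _ h dc dt du => fun g =>
      let: (gG, gD) := delta h g in
      if sem dc gG then sem dt gD else sem du gD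
  | ty_unwk _ _ _ _ d => fun g => sem d (add_unit g)
  | ty_wk _ _ _ _ d => fun g => sem d (drop_unit g)
  end.

(* Instances of the equations, [cl_eq s t u] being t == u at type s.

   The equation  let p = v in u == u[v/p]  is for all patterns p and all values
   v, so a variable v may meet a pair pattern.  The substitution u[v/p] then
   replaces the bound variables componentwise if v matches p ([eq_beta],
   [eq_beta_pair]), and it replaces the pattern itself, seen as a term, by v if
   its variables occur in u only as the pair (x, y): that is, if
   u = e[(x, y)/z], then u[v/(x, y)] = e[v/z] ([eq_beta_fold]).  On pairs v the
   two readings agree; the second is what gives the equation a meaning when v
   is a variable. *)
Inductive cl_eq : ty -> term -> term -> Prop :=
| eq_beta s v u : value v ->
    cl_eq s (Let PVar v u) (subst1 v u)
| eq_beta_pair s v w u : value v -> value w ->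
    cl_eq s (Let PPair (Pair v w) u) (subst2 v w u)
| eq_beta_fold s v e : value v ->
    cl_eq s (Let PPair v (fold_pair e)) (subst1 v e)
| eq_let_pair s t u e :
    cl_eq s (Let PPair (Pair t u) e) (Let PVar t (Let PVar (shift 1 u) e))
| eq_if_ff s t u : cl_eq s (If Ff t u) u
| eq_if_tt s t u : cl_eq s (If Tt t u) t
| eq_eta_unit t : cl_eq Q1 Unit t
| eq_eta_let s t : cl_eq s (Let PVar t (Var 0)) t
| eq_eta_pair s t : cl_eq s (Let PPair t (Pair (Var 1) (Var 0))) t
| eq_eta_if s t : cl_eq s (If t Tt Ff) t
| eq_let_let s p q t u e :
    cl_eq s (Let p t (Let q (shift (arity p) u) e))
            (Let q u (Let p (shift (arity q) t)
                            (swap_blocks (arity q) (arity p) e)))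
| eq_let_if s p t u0 u1 e :
    cl_eq s (Let p (If t u0 u1) e) (If t (Let p u0 e) (Let p u1 e)).

(* [ceq G t u s] is the judgement G |- t == u : s : every instance of an
   equation used has both sides of the given type in the current context. *)
Inductive ceq : ctx -> term -> term -> ty -> Prop :=
| ceq_ax G t u s : cl_eq s t u -> typing G t s -> typing G u s -> ceq G t u s
| ceq_refl G t s : typing G t s -> ceq G t t s
| ceq_sym G t u s : ceq G t u s -> ceq G u t s
| ceq_trans G t u v s : ceq G t u s -> ceq G u v s -> ceq G t v s
| ceq_let G D T s s' t t' u u' :
    merge G D T -> ceq G t t' s -> ceq (Some s :: D) u u' s' ->
    ceq T (Let PVar t u) (Let PVar t' u') s'
| ceq_pair G D T s s' t t' u u' :
    merge G D T -> ceq G t t' s -> ceq D u u' s' ->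
    ceq T (Pair t u) (Pair t' u') (Tens s s')
| ceq_letpair G D T s s' r t t' u u' :
    merge G D T -> ceq G t t' (Tens s s') ->
    ceq (Some s' :: Some s :: D) u u' r ->
    ceq T (Let PPair t u) (Let PPair t' u') r
| ceq_if G D T s c c' t t' u u' :
    merge G D T -> ceq G c c' Q2 -> ceq D t t' s -> ceq D u u' s ->
    ceq T (If c t u) (If c' t' u') s
| ceq_unwk G1 G2 t u s :
    ceq (G1 ++ Some Q1 :: G2) t u s -> ceq (G1 ++ None :: G2) t u s
| ceq_wk G1 G2 t u s :
    ceq (G1 ++ None :: G2) t u s -> ceq (G1 ++ Some Q1 :: G2) t u s.

Lemma ceq_typed G t u s :
  ceq G t u s -> inhabited (typing G t s) /\ inhabited (typing G u s).
Proof.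
elim=> {G t u s}.
- by move=> *; split; constructor.
- by move=> *; split; constructor.
- by move=> G t u s _ [].
- by move=> G t u v s _ [? _] _ [_ ?]; split.
- move=> G D T s s' t t' u u' m _ [[a] [a']] _ [[b] [b']].
  by split; constructor; apply: ty_let m _ _; eassumption.
- move=> G D T s s' t t' u u' m _ [[a] [a']] _ [[b] [b']].
  by split; constructor; apply: ty_pair m _ _.
- move=> G D T s s' r t t' u u' m _ [[a] [a']] _ [[b] [b']].
  by split; constructor; apply: ty_letpair m _ _; eassumption.
- move=> G D T s c c' t t' u u' m _ [[a] [a']] _ [[b] [b']] _ [[d] [d']].
  by split; constructor; apply: ty_if m _ _ _.
- by move=> G1 G2 t u s _ [[a] [b]]; split; constructor; apply: ty_unwk.
- by move=> G1 G2 t u s _ [[a] [b]]; split; constructor; apply: ty_wk.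
Qed.

(* Main.v *)
(** Terms with equal semantics agree on closed instances: substituting closed
    values for the variables of t makes it provably equal to the closed value
    that its semantics returns.  Agreement on closed instances is then lifted to
    open terms by induction on the size of the context.  A variable x : Q2 is
    eliminated through t == if x then t[true/x] else t[false/x], and
    x : s (x) s' through t == let (a, b) = x in t[(a, b)/x].

    The weakening rules let a name of type Q1, or absent from the context, occur
    in a term at type Q1, and a name may even occur at Q1 and at its declared
    type in the same term: such terms are not stable under substitution.  One
    therefore first replaces all variables of type Q1 by (); after that,
    strictness says that the free variables are exactly the variables of the
    context whose type is not Q1. *)

From Stdlib Require Import Setoid.
Require Import Defs.
From mathcomp Require Import all_boot.

Set Implicit Arguments.
Unset Strict Implicit.
Unset Printing Implicit Defensive.

(** * Renaming and substitution *)

Definition scons T (x : T) (f : nat -> T) : nat -> T :=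
  fun i => if i is j.+1 then f j else x.

Lemma eq_upr r r' : r =1 r' -> upr r =1 upr r'.
Proof. by move=> e [|i] //=; rewrite e. Qed.

Lemma eq_ups s s' : s =1 s' -> ups s =1 ups s'.
Proof. by move=> e [|i] //=; rewrite e. Qed.

Lemma eq_rename r r' t : r =1 r' -> rename r t = rename r' t.
Proof.
elim: t r r' => //= [i|t IHt u IHu|p t IHt u IHu|c IHc t IHt u IHu] r r' e.
- by rewrite e.
- by rewrite (IHt _ _ e) (IHu _ _ e).
- by rewrite (IHt _ _ e); congr Let; apply: IHu; case: p => /=;
    do ?apply: eq_upr.
- by rewrite (IHc _ _ e) (IHt _ _ e) (IHu _ _ e).
Qed.

Lemma eq_subst s s' t : s =1 s' -> subst s t = subst s' t.
Proof.
elim: t s s' => //= [t IHt u IHu|p t IHt u IHu|c IHc t IHt u IHu] s s' e.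
- by rewrite (IHt _ _ e) (IHu _ _ e).
- by rewrite (IHt _ _ e); congr Let; apply: IHu; case: p => /=;
    do ?apply: eq_ups.
- by rewrite (IHc _ _ e) (IHt _ _ e) (IHu _ _ e).
Qed.

Lemma subst_id s t : s =1 Var -> subst s t = t.
Proof.
have ups_id f : f =1 Var -> ups f =1 Var by move=> e [|i] //=; rewrite e.
elim: t s => //= [t IHt u IHu|p t IHt u IHu|c IHc t IHt u IHu] s e.
- by rewrite IHt // IHu.
- rewrite IHt // IHu //; case: p => /=; first exact: ups_id.
  by apply/ups_id/ups_id.
- by rewrite IHc // IHt // IHu.
Qed.

Lemma subst_rename s r t : subst s (rename r t) = subst (s \o r) t.
Proof.
have ups_upr f g : ups f \o upr g =1 ups (f \o g) by case.
elim: t s r => //= [t IHt u IHu|p t IHt u IHu|c IHc t IHt u IHu] s r.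
- by rewrite IHt IHu.
- rewrite IHt IHu; congr Let; apply: eq_subst; case: p => //= i.
  by rewrite ups_upr; apply: eq_ups.
- by rewrite IHc IHt IHu.
Qed.

Lemma rename_rename r r' t : rename r (rename r' t) = rename (r \o r') t.
Proof.
have upr_upr f g : upr f \o upr g =1 upr (f \o g) by case.
elim: t r r' => //= [t IHt u IHu|p t IHt u IHu|c IHc t IHt u IHu] r r'.
- by rewrite IHt IHu.
- rewrite IHt IHu; congr Let; apply: eq_rename; case: p => //= i.
  by rewrite upr_upr; apply: eq_upr.
- by rewrite IHc IHt IHu.
Qed.

Lemma rename_subst r s t : rename r (subst s t) = subst (rename r \o s) t.
Proof.
have upr_ups f g : rename (upr f) \o ups g =1 ups (rename f \o g).
  by case=> //= i; rewrite /shift !rename_rename; apply: eq_rename.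
elim: t r s => //= [t IHt u IHu|p t IHt u IHu|c IHc t IHt u IHu] r s.
- by rewrite IHt IHu.
- rewrite IHt IHu; congr Let; apply: eq_subst; case: p => //= i.
  by rewrite upr_ups; apply: eq_ups.
- by rewrite IHc IHt IHu.
Qed.

Lemma subst_subst s s' t : subst s (subst s' t) = subst (subst s \o s') t.
Proof.
have ups_ups f g : subst (ups f) \o ups g =1 ups (subst f \o g).
  by case=> //= i; rewrite /shift subst_rename rename_subst; apply: eq_subst.
elim: t s s' => //= [t IHt u IHu|p t IHt u IHu|c IHc t IHt u IHu] s s'.
- by rewrite IHt IHu.
- rewrite IHt IHu; congr Let; apply: eq_subst; case: p => //= i.
  by rewrite ups_ups; apply: eq_ups.
- by rewrite IHc IHt IHu.
Qed.

(** * Free variables *)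

Fixpoint fv (t : term) : pred nat :=
  match t with
  | Var x => pred1 x
  | Pair t u => predU (fv t) (fv u)
  | Let p t u => fun i => fv t i || fv u (arity p + i)
  | If c t u => fun i => [|| fv c i, fv t i | fv u i]
  | _ => pred0
  end.

Lemma ex_orb (P Q : pred nat) (R : nat -> Prop) :
  (exists2 j, P j || Q j & R j) <->
  (exists2 j, P j & R j) \/ (exists2 j, Q j & R j).
Proof.
split=> [[j /orP[] ? ?]|[[j Hj ?]|[j Hj ?]]]; [left|right|..]; exists j => //.
  by rewrite Hj.
by rewrite Hj orbT.
Qed.

Lemma fv_rename r t i : fv (rename r t) i <-> exists2 j, fv t j & r j = i.
Proof.
have none (R : nat -> Prop) : false <-> exists2 j, pred0 j & R j.
  by split=> // -[].
have upP (P : pred nat) f k :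
    (exists2 j, P j & upr f j = k.+1) <-> exists2 j, P j.+1 & f j = k.
  split=> [[[|j] //= Hj [<-]]|[j Hj <-]]; [by exists j|by exists j.+1].
elim: t r i => //= [x|t IHt u IHu|p t IHt u IHu|c IHc t IHt u IHu] r i.
- by split=> [/eqP->|[j /eqP-> ->]] //; exists x => //=.
- by rewrite ex_orb -IHt -IHu; split=> /orP.
- rewrite ex_orb -IHt; case: p; rewrite /= ?add1n ?add2n.
    by rewrite -upP -IHu; split=> /orP.
  by rewrite -(upP (fun j => fv u j.+1)) -upP -IHu; split=> /orP.
- by rewrite ex_orb (ex_orb (fv t)) -IHc -IHt -IHu; split=> [/or3P[]|[|[]] ->];
    rewrite ?orbT; auto.
Qed.

Lemma fv_shift0 t : fv (shift 1 t) 0 = false.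
Proof. by apply/negP=> /fv_rename[]. Qed.

Lemma fv_shiftS t i : fv (shift 1 t) i.+1 = fv t i.
Proof.
by apply/idP/idP=> [/fv_rename[j Hj [<-]] //|Hi]; apply/fv_rename; exists i.
Qed.

Lemma fv_subst s t i : fv (subst s t) i <-> exists2 j, fv t j & fv (s j) i.
Proof.
have none (R : nat -> Prop) : false <-> exists2 j, pred0 j & R j.
  by split=> // -[].
have upP (P : pred nat) f k :
    (exists2 j, P j & fv (ups f j) k.+1) <-> exists2 j, P j.+1 & fv (f j) k.
  split=> [[[|j] //= Hj]|[j Hj Hk]]; rewrite ?fv_shiftS; first by exists j.
  by exists j.+1; rewrite /= ?fv_shiftS.
elim: t s i => //= [x|t IHt u IHu|p t IHt u IHu|c IHc t IHt u IHu] s i.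
- by split=> [?|[j /eqP->]] //; exists x => //=.
- by rewrite ex_orb -IHt -IHu; split=> /orP.
- rewrite ex_orb -IHt; case: p; rewrite /= ?add1n ?add2n.
    by rewrite -upP -IHu; split=> /orP.
  by rewrite -(upP (fun j => fv u j.+1)) -upP -IHu; split=> /orP.
- by rewrite ex_orb (ex_orb (fv t)) -IHc -IHt -IHu; split=> [/or3P[]|[|[]] ->];
    rewrite ?orbT; auto.
Qed.

Lemma fv_subst_ups0 s t : fv (subst (ups s) t) 0 = fv t 0.
Proof.
apply/idP/idP=> [/fv_subst[[|j] //=]|H0]; first by rewrite fv_shift0.
by apply/fv_subst; exists 0.
Qed.

Lemma fv_subst_upsS s t i :
  fv (subst (ups s) t) i.+1 <-> exists2 j, fv t j.+1 & fv (s j) i.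
Proof.
rewrite fv_subst; split=> [[[|j] //= Hj]|[j Hj Hk]]; rewrite ?fv_shiftS.
  by exists j.
by exists j.+1; rewrite /= ?fv_shiftS.
Qed.

(** * Simple typing of clean terms *)

Definition nontriv (s : ty) : bool := if s is Q1 then false else true.

(* Simple typing of terms without variables of type Q1; the side conditions on
   free variables express strictness under binders and in branches. *)
Inductive wt (Th : nat -> ty) : term -> ty -> Prop :=
| wt_var x s : Th x = s -> nontriv s -> wt Th (Var x) s
| wt_unit : wt Th Unit Q1
| wt_ff : wt Th Ff Q2
| wt_tt : wt Th Tt Q2
| wt_let s s' t u :
    wt Th t s -> wt (scons s Th) u s' -> fv u 0 = nontriv s ->
    wt Th (Let PVar t u) s'
| wt_pair s s' t u : wt Th t s -> wt Th u s' -> wt Th (Pair t u) (Tens s s')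
| wt_letpair s s' r t u :
    wt Th t (Tens s s') -> wt (scons s' (scons s Th)) u r ->
    fv u 0 = nontriv s' -> fv u 1 = nontriv s -> wt Th (Let PPair t u) r
| wt_if s c t u :
    wt Th c Q2 -> wt Th t s -> wt Th u s -> fv t =1 fv u -> wt Th (If c t u) s.

Lemma wt_fv Th t s x : wt Th t s -> fv t x -> nontriv (Th x).
Proof.
move=> d; elim: d x => {Th t s} //=.
- by move=> Th x s <- ? y /eqP->.
- by move=> Th s s' t u _ IHt _ IHu _ x /orP[/IHt|/IHu].
- by move=> Th s s' t u _ IHt _ IHu x /orP[/IHt|/IHu].
- by move=> Th s s' r t u _ IHt _ IHu _ _ x /orP[/IHt|/IHu].
- by move=> Th s c t u _ IHc _ IHt _ IHu _ x /or3P[/IHc|/IHt|/IHu].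
Qed.

(** The renaming may identify variables: the side conditions survive because a lifted renaming sends
    no other index to a bound one, and the free variables of a renamed term depend only on those of
    the term. *)
Lemma wt_rename Th Th' r t s :
  wt Th t s -> (forall x, fv t x -> Th' (r x) = Th x) -> wt Th' (rename r t) s.
Proof.
have upr0 f u : fv (rename (upr f) u) 0 = fv u 0.
  apply/idP/idP=> [/fv_rename[[|j] //]|H0].
  by apply/fv_rename; exists 0.
have upr1 f u : fv (rename (upr (upr f)) u) 1 = fv u 1.
  apply/idP/idP=> [/fv_rename[[|[|j]] //]|H0].
  by apply/fv_rename; exists 1.
move=> d; elim: d r Th' => {Th t s} /=; try by constructor.
- by move=> Th x s <- nt r Th' e; constructor => //; apply: e => /=.
- move=> Th s s' t u _ IHt _ IHu u0 r Th' e; apply: (wt_let (s := s)).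
  + by apply: IHt => x Hx; apply: e; rewrite Hx.
  + by apply: IHu => -[|x] //= Hx; apply: e; rewrite add1n Hx orbT.
  + by rewrite upr0.
- move=> Th s s' t u _ IHt _ IHu r Th' e; constructor.
  + by apply: IHt => x Hx; apply: e; rewrite Hx.
  + by apply: IHu => x Hx; apply: e; rewrite Hx orbT.
- move=> Th s s' ? t u _ IHt _ IHu u0 u1 r Th' e.
  apply: (wt_letpair (s := s) (s' := s')).
  + by apply: IHt => x Hx; apply: e; rewrite Hx.
  + by apply: IHu => -[|[|x]] //= Hx; apply: e; rewrite add2n Hx orbT.
  + by rewrite upr0.
  + by rewrite upr1.
- move=> Th s c t u _ IHc _ IHt _ IHu etu r Th' e; constructor.
  + by apply: IHc => x Hx; apply: e; rewrite Hx.
  + by apply: IHt => x Hx; apply: e; rewrite Hx orbT.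
  + by apply: IHu => x Hx; apply: e; rewrite Hx !orbT.
  + by move=> i; apply/idP/idP=> /fv_rename[j Hj <-]; apply/fv_rename;
      exists j; rewrite // ?etu // -etu.
Qed.

Lemma wt_subst Th Th' f t s :
  wt Th t s -> (forall x, fv t x -> wt Th' (f x) (Th x)) ->
  wt Th' (subst f t) s.
Proof.
(* The bound variable must have a type other than Q1 only if it occurs, and then strictness says
   that it has. *)
have ups_wt g a T T' x : (x = 0 -> nontriv a) ->
    (forall y, x = y.+1 -> wt T' (g y) (T y)) ->
    wt (scons a T') (ups g x) (scons a T x).
  case: x => [|x] /= H0 H1; first by constructor=> //; apply: H0.
  by apply: wt_rename (H1 _ erefl) _.
move=> d; elim: d f Th' => {Th t s} /=; try by constructor.
- by move=> Th x s <- nt r Th' e; apply: e => /=.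
- move=> Th s s' t u _ IHt _ IHu u0 r Th' e; apply: (wt_let (s := s)).
  + by apply: IHt => x Hx; apply: e; rewrite Hx.
  + apply: IHu => x Hx; apply/ups_wt=> [ex|y ex]; first by rewrite -u0 -ex.
    by apply: e; rewrite add1n -ex Hx orbT.
  + by rewrite fv_subst_ups0.
- move=> Th s s' t u _ IHt _ IHu r Th' e; constructor.
  + by apply: IHt => x Hx; apply: e; rewrite Hx.
  + by apply: IHu => x Hx; apply: e; rewrite Hx orbT.
- move=> Th s s' ? t u _ IHt _ IHu u0 u1 r Th' e.
  apply: (wt_letpair (s := s) (s' := s')).
  + by apply: IHt => x Hx; apply: e; rewrite Hx.
  + apply: IHu => x Hx; apply/ups_wt=> [ex|y ex]; first by rewrite -u0 -ex.
    apply/ups_wt=> [ey|z ey]; first by rewrite -u1 -ey -ex.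
    by apply: e; rewrite add2n -ey -ex Hx orbT.
  + by rewrite fv_subst_ups0.
  + rewrite -u1; apply/idP/idP=> [/fv_subst_upsS[[|j] //=]|H1].
      by rewrite fv_shift0.
    by apply/fv_subst_upsS; exists 0.
- move=> Th s c t u _ IHc _ IHt _ IHu etu r Th' e; constructor.
  + by apply: IHc => x Hx; apply: e; rewrite Hx.
  + by apply: IHt => x Hx; apply: e; rewrite Hx orbT.
  + by apply: IHu => x Hx; apply: e; rewrite Hx !orbT.
  + by move=> i; apply/idP/idP=> /fv_subst[j Hj Hi]; apply/fv_subst;
      exists j; rewrite // ?etu // -etu.
Qed.

(** * Contexts given by sets of variables *)

(** One total type assignment serves all contexts, so that merging them amounts to a union of
    predicates. *)
Definition mkctx (Th : nat -> ty) n (A : pred nat) : ctx :=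
  mkseq (fun i => if A i then Some (Th i) else None) n.

Lemma eq_mkctx Th n A B : (forall i, i < n -> A i = B i) ->
  mkctx Th n A = mkctx Th n B.
Proof.
move=> e; apply/eq_in_map=> i; rewrite mem_iota => /andP[_ Hi].
by rewrite e.
Qed.

Lemma mkctxS Th n A :
  mkctx Th n.+1 A =
  (if A 0 then Some (Th 0) else None) :: mkctx (Th \o succn) n (A \o succn).
Proof. by rewrite /mkctx /mkseq /= (iotaDl 1 0 n) -map_comp. Qed.

Lemma mkctx_scons s Th n A :
  mkctx (scons s Th) n.+1 A =
  (if A 0 then Some s else None) :: mkctx Th n (A \o succn).
Proof. by rewrite mkctxS. Qed.

Lemma mkctx_none Th n A : (forall i, i < n -> A i = false) ->
  mkctx Th n A = nseq n None.
Proof.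
elim: n Th A => // n IH Th A e; rewrite mkctxS e //= IH // => i Hi.
exact: e.
Qed.

Lemma mkctx_merge Th n A B C : (forall i, i < n -> C i = A i || B i) ->
  inhabited (Defs.merge (mkctx Th n A) (mkctx Th n B) (mkctx Th n C)).
Proof.
elim: n Th A B C => [|n IH] Th A B C e; first by do 2!constructor.
have [|m] := IH (Th \o succn) (A \o succn) (B \o succn) (C \o succn).
  by move=> i Hi; apply: e.
by rewrite !mkctxS e //; case: (A 0); case: (B 0); do 2!constructor.
Qed.

Lemma mkctx_single Th n x :
  x < n -> inhabited (single (mkctx Th n (pred1 x)) x (Th x)).
Proof.
elim: n Th x => [|n IH] Th [|x] // Hx; rewrite mkctxS /=.
  by rewrite mkctx_none //; do 2!constructor.
by case: (IH (Th \o succn) x Hx) => h; constructor; apply: single_there.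
Qed.

(** A bound variable of type Q1 is missing from [A], while the typing rule of the binder demands an
    entry for it; wk-unit supplies the entry. *)
Lemma ceq_binder s Th n A t u r :
  A 0 = nontriv s -> ceq (mkctx (scons s Th) n.+1 A) t u r ->
  ceq (Some s :: mkctx Th n (A \o succn)) t u r.
Proof.
rewrite mkctx_scons => ->; case: s => //= h.
exact: (ceq_wk (G1 := [::]) h).
Qed.

Lemma ceq_binder2 s s' Th n A t u r :
  A 0 = nontriv s' -> A 1 = nontriv s ->
  ceq (mkctx (scons s' (scons s Th)) n.+2 A) t u r ->
  ceq (Some s' :: Some s :: mkctx Th n (A \o succn \o succn)) t u r.
Proof.
move=> e0 e1 /(ceq_binder e0); rewrite mkctx_scons /= e1.
by case: s {e1} => //= h; apply: (ceq_wk (G1 := [:: Some s']) h).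
Qed.

(** Reflexivity stands in for typability: [wt] and the conclusion of [mkctx_merge] live in [Prop],
    so they cannot produce a derivation in [Type], but they can produce a [ceq]. *)
Lemma wt_ceq_refl Th n A t s : wt Th t s -> fv t =1 A ->
  (forall i, A i -> i < n) -> ceq (mkctx Th n A) t t s.
Proof.
have leaf T k B : pred0 =1 B -> mkctx T k B = nseq k None.
  by move=> e; apply: mkctx_none => i _; rewrite -e.
move=> d; elim: d n A => {Th t s} /=.
- move=> Th x s <- _ n A e le.
  have [|h] := @mkctx_single Th n x; first by apply: le; rewrite -e /=.
  by rewrite (eq_mkctx _ (B := pred1 x)) //; apply/ceq_refl/ty_var.
- by move=> Th n A /leaf-> _; apply/ceq_refl/ty_unit.
- by move=> Th n A /leaf-> _; apply/ceq_refl/ty_ff.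
- by move=> Th n A /leaf-> _; apply/ceq_refl/ty_tt.
- move=> Th s s' t u _ IHt _ IHu u0 n A e le.
  have [|m] := @mkctx_merge Th n (fv t) (fv u \o succn) A.
    by move=> i _; rewrite -e.
  apply: (ceq_let m (s := s)).
    by apply: IHt => // i Hi; apply: le; rewrite -e Hi.
  apply: ceq_binder => //; apply: IHu => // -[|i] // Hi.
  by apply: le; rewrite -e add1n Hi orbT.
- move=> Th s s' t u _ IHt _ IHu n A e le.
  have [|m] := @mkctx_merge Th n (fv t) (fv u) A.
    by move=> i _; rewrite -e.
  apply: (ceq_pair m).
    by apply: IHt => // i Hi; apply: le; rewrite -e /= Hi.
  by apply: IHu => // i Hi; apply: le; rewrite -e /= Hi orbT.
- move=> Th s s' r t u _ IHt _ IHu u0 u1 n A e le.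
  have [|m] := @mkctx_merge Th n (fv t) (fv u \o succn \o succn) A.
    by move=> i _; rewrite -e.
  apply: (ceq_letpair m (s := s) (s' := s')).
    by apply: IHt => // i Hi; apply: le; rewrite -e Hi.
  apply: ceq_binder2 => //; apply: IHu => // -[|[|i]] // Hi.
  by apply: le; rewrite -e add2n Hi orbT.
- move=> Th s c t u _ IHc _ IHt _ IHu etu n A e le.
  have [|m] := @mkctx_merge Th n (fv c) (fv t) A.
    by move=> i _; rewrite -e etu orbb.
  apply: (ceq_if m).
  + by apply: IHc => // i Hi; apply: le; rewrite -e Hi.
  + by apply: IHt => // i Hi; apply: le; rewrite -e Hi orbT.
  + by apply: IHu => // i Hi; apply: le; rewrite -e -etu Hi !orbT.
Qed.

Lemma ceq_eqn G t u s :
  cl_eq s t u -> ceq G t t s -> ceq G u u s -> ceq G t u s.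
Proof. by move=> e /ceq_typed[[dt] _] /ceq_typed[[du] _]; apply: ceq_ax. Qed.

Lemma wt_ceq Th n A t u s : cl_eq s t u -> wt Th t s -> wt Th u s ->
  fv t =1 A -> fv u =1 A -> (forall i, A i -> i < n) ->
  ceq (mkctx Th n A) t u s.
Proof. by move=> e *; apply: ceq_eqn => //; apply: wt_ceq_refl. Qed.

(** * Closed values *)

Fixpoint quote s : ty_sem s -> term :=
  match s with
  | Q1 => fun=> Unit
  | Q2 => fun b => if b then Tt else Ff
  | Tens s s' => fun a => Pair (quote a.1) (quote a.2)
  end.

Lemma fv_quote s (a : ty_sem s) : fv (quote a) =1 pred0.
Proof.
elim: s a => [|[]|s IH s' IH'] //= [a b] i /=.
by rewrite IH IH'.
Qed.

Lemma value_quote s (a : ty_sem s) : value (quote a).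
Proof.
by elim: s a => [|[]|s IH s' IH' [a b]] /=; constructor.
Qed.

Lemma wt_quote Th s (a : ty_sem s) : wt Th (quote a) s.
Proof.
by elim: s a => [|[]|s IH s' IH' [a b]] /=; constructor.
Qed.

Lemma subst_quote f s (a : ty_sem s) : subst f (quote a) = quote a.
Proof.
elim: s a => [|[]|s IH s' IH'] //= [a b] /=.
by rewrite IH IH'.
Qed.

Lemma rename_quote f s (a : ty_sem s) : rename f (quote a) = quote a.
Proof.
elim: s a => [|[]|s IH s' IH'] //= [a b] /=.
by rewrite IH IH'.
Qed.

Lemma quote_ceq_refl n s (a : ty_sem s) :
  ceq (nseq n None) (quote a) (quote a) s.
Proof.
rewrite -(@mkctx_none (fun=> Q1) n pred0) //.
by apply: wt_ceq_refl => //; [apply: wt_quote|apply: fv_quote].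
Qed.

Lemma ceq_reflL G t u s : ceq G t u s -> ceq G t t s.
Proof. by move=> h; apply: (ceq_trans h (ceq_sym h)). Qed.

(** Using an equation requires both of its sides to be typed; here this is read off the equalities
    on either side of it. *)
Lemma ceq_step G t t1 t2 t3 s :
  ceq G t t1 s -> cl_eq s t1 t2 -> ceq G t2 t3 s -> ceq G t t3 s.
Proof.
move=> h1 e h2; apply: (ceq_trans h1); apply: ceq_trans (h2).
by apply: ceq_eqn => //; apply: ceq_reflL; [apply: ceq_sym h1|apply: h2].
Qed.

Lemma merge_nseq n :
  inhabited (Defs.merge (nseq n None) (nseq n None) (nseq n None)).
Proof.
elim: n => [|n [m]]; constructor; first exact: merge_nil.
exact: merge_none m.
Qed.

(** Used after a beta step in a closed instance, to absorb the contracted variable into the closing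
    substitution. *)
Lemma subst1_ups v f u : subst1 v (subst (ups f) u) = subst (scons v f) u.
Proof.
rewrite /subst1 subst_subst; apply: eq_subst => -[|i] //=.
by rewrite subst_rename subst_id.
Qed.

Lemma subst2_ups v w f u :
  subst2 v w (subst (ups (ups f)) u) = subst (scons w (scons v f)) u.
Proof.
rewrite /subst2 subst_subst; apply: eq_subst => -[|[|i]] //=.
by rewrite !subst_rename subst_id.
Qed.

(** * Clean forms and their closed instances *)

(** Variables of type Q1 are left out: what remains is the set that strictness forces to occur. *)
Definition dom (G : ctx) : pred nat :=
  fun i => if nth None G i is Some s then nontriv s else false.

Definition types (Th : nat -> ty) (G : ctx) : Prop :=
  forall i s, nth None G i = Some s -> nontriv s -> Th i = s.

(* Nothing is required at variables of type Q1 or outside the domain. *)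
Fixpoint closing (G : ctx) : env G -> (nat -> term) -> Prop :=
  match G return env G -> (nat -> term) -> Prop with
  | [::] => fun _ _ => True
  | Some s :: G => fun g f =>
      (nontriv s -> f 0 = quote g.2) /\ closing g.1 (f \o succn)
  | None :: G => fun g f => @closing G g (f \o succn)
  end.

Lemma closing_val G (g : env G) f i s : closing g f ->
  nth None G i = Some s -> nontriv s -> exists a : ty_sem s, f i = quote a.
Proof.
elim: G g f i => [|[s'|] G IH] g f [|i] //=.
- by move=> [f0 _] [<-] nt; exists g.2; apply: f0.
- by move=> [_ cl]; apply: IH cl.
- exact: IH.
Qed.

(** Entries of type Q1 put no condition on [f]; the environment takes [tt] there. *)
Lemma closing_exists G f :
  (forall i s, nth None G i = Some s -> nontriv s ->
     exists a : ty_sem s, f i = quote a) ->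
  exists g : env G, closing g f.
Proof.
elim: G f => [|[s|] G IH] f H; first by exists tt.
- have [i|g cl] := IH (f \o succn); first exact: (H i.+1).
  case nt: (nontriv s).
    by have [a fa] := H 0 s erefl nt; exists (g, a).
  by case: s nt {H} => // _; exists (g, tt).
- by apply: IH => i; apply: (H i.+1).
Qed.

Lemma merge_dom G D T : Defs.merge G D T -> dom T =1 predU (dom G) (dom D).
Proof.
elim=> {G D T} [i|G D T _ IH|s G D T _ IH|s G D T _ IH|s G D T _ IH];
  first (by case: i); case=> [|i] //; try exact: IH; rewrite /dom /=.
- by rewrite orbb.
- by rewrite orbF.
Qed.

Lemma merge_types Th G D T :
  Defs.merge G D T -> types Th T -> types Th G /\ types Th D.
Proof.
move=> m.
suff [HG HD] : (forall i s, nth None G i = Some s -> nth None T i = Some s) /\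
    (forall i s, nth None D i = Some s -> nth None T i = Some s).
  by move=> ty; split=> i s E nt; apply: ty => //; [apply: HG|apply: HD].
elim: m => {G D T} // [G D T _ [HG HD]|s G D T _ [HG HD]|s G D T _ [HG HD]|
  s G D T _ [HG HD]]; by split=> -[|i] s' //=; auto.
Qed.

Lemma merge_closing G D T (m : Defs.merge G D T) (g : env T) f : closing g f ->
  closing (delta m g).1 f /\ closing (delta m g).2 f.
Proof.
elim: m g f => {G D T} //= [G D T m IH|s G D T m IH|s G D T m IH|s G D T m IH]
  g f.
- exact: IH.
- by move=> [f0 /IH]; case: (delta m g.1) => gG gD [].
- by move=> [f0 /IH]; case: (delta m g.1) => gG gD [].
- by move=> [f0 /IH]; case: (delta m g.1) => gG gD [].
Qed.

Lemma types_cons Th s G : types Th G -> types (scons s Th) (Some s :: G).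
Proof. by move=> ty [|i] s' /=; [case|apply: ty]. Qed.

Lemma types_exists G : exists Th, types Th G.
Proof.
exists (fun i => if nth None G i is Some s then s else Q1) => i s.
by move=> ->.
Qed.

Lemma single_cat G x s :
  single G x s -> exists k, G = nseq x None ++ Some s :: nseq k None.
Proof.
by elim=> {G x s} [k s|G x s _ [k ->]]; exists k.
Qed.

Lemma dom_single G x s : single G x s -> nontriv s -> dom G =1 pred1 x.
Proof.
rewrite /dom; elim=> {G x s} [k s|G x s _ IH] nt [|i] //=; last exact: IH.
by rewrite nth_nseq if_same.
Qed.

Lemma nth_single G x s : single G x s -> nth None G x = Some s.
Proof. by elim. Qed.

Lemma dom_nseq k : dom (nseq k None) =1 pred0.
Proof. by move=> i; rewrite /dom nth_nseq if_same. Qed.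

Lemma closing_lookup G x s (h : single G x s) (g : env G) f :
  closing g f -> nontriv s -> f x = quote (lookup h g).
Proof.
elim: h g f => {G x s} [k s|G x s h IH] g f /=; first by case.
by move=> /IH; apply.
Qed.

Lemma nth_unit G1 G2 i s : nontriv s ->
  nth None (G1 ++ Some Q1 :: G2) i = Some s <->
  nth None (G1 ++ None :: G2) i = Some s.
Proof.
move=> nt; elim: G1 i => [|o G1 IH] [|i] //=.
by split=> // -[es]; rewrite -es in nt.
Qed.

Lemma dom_unit G1 G2 : dom (G1 ++ Some Q1 :: G2) =1 dom (G1 ++ None :: G2).
Proof. by rewrite /dom; elim: G1 => [|o G1 IH] [|i] //=; apply: IH. Qed.

Lemma closing_add G1 G2 (g : env (G1 ++ None :: G2)) f :
  closing g f -> closing (add_unit g) f.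
Proof.
elim: G1 g f => [|[s|] G1 IH] g f //=; last exact: IH.
by move=> [f0 /IH].
Qed.

Lemma closing_drop G1 G2 (g : env (G1 ++ Some Q1 :: G2)) f :
  closing g f -> closing (drop_unit g) f.
Proof.
elim: G1 g f => [|[s|] G1 IH] g f //=; last exact: IH.
  by case.
by move=> [f0 /IH].
Qed.

(** Congruence for [Let] needs a well-typed body before the beta step, when the bound variable is
    still open; all other free variables have become closed values by then. *)
Lemma subst_ups_ceq_refl Th s u r f n :
  wt (scons s Th) u r -> fv u 0 = nontriv s ->
  (forall i, fv u i.+1 -> exists a : ty_sem (Th i), f i = quote a) ->
  ceq (Some s :: nseq n None) (subst (ups f) u) (subst (ups f) u) r.
Proof.
move=> du u0 cl; set u' := subst _ u.
have u'S i : fv u' i.+1 = false.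
  by apply/negP=> /fv_subst_upsS[j /cl[a ->]]; rewrite fv_quote.
have u'0 : fv u' 0 = nontriv s by rewrite fv_subst_ups0.
rewrite -(@mkctx_none Th n (fv u' \o succn)); last by move=> i _; apply: u'S.
apply: ceq_binder => //.
apply: wt_ceq_refl => // [|[|i]] //; last by rewrite u'S.
apply: wt_subst du _ => -[|i] Hi /=; first by constructor; rewrite -?u0.
by have [a ->] := cl _ Hi; rewrite /shift rename_quote; apply: wt_quote.
Qed.

Lemma subst_ups2_ceq_refl Th s s' u r f n :
  wt (scons s' (scons s Th)) u r -> fv u 0 = nontriv s' -> fv u 1 = nontriv s ->
  (forall i, fv u i.+2 -> exists a : ty_sem (Th i), f i = quote a) ->
  ceq (Some s' :: Some s :: nseq n None)
    (subst (ups (ups f)) u) (subst (ups (ups f)) u) r.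
Proof.
move=> du u0 u1 cl; set u' := subst _ u.
have u'S i : fv u' i.+2 = false.
  apply/negP=> /fv_subst_upsS[[|j]] //= Hj; rewrite fv_shiftS.
  by have [a ->] := cl _ Hj; rewrite fv_quote.
have u'0 : fv u' 0 = nontriv s' by rewrite fv_subst_ups0.
have u'1 : fv u' 1 = nontriv s.
  rewrite -u1; apply/idP/idP=> [/fv_subst_upsS[[|j] //=]|H1].
    by rewrite fv_shift0.
  by apply/fv_subst_upsS; exists 0.
rewrite -(@mkctx_none Th n (fv u' \o succn \o succn)); last first.
  by move=> i _; apply: u'S.
apply: ceq_binder2 => //.
apply: wt_ceq_refl => // [|[|[|i]]] //; last by rewrite u'S.
apply: wt_subst du _ => -[|[|i]] Hi /=; try by constructor; rewrite -?u0 -?u1.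
by have [a ->] := cl _ Hi; rewrite /shift !rename_quote; apply: wt_quote.
Qed.

(** Induction on the derivation, because the semantics recurses on it. The term [t'] is [t] with
    each variable typed at Q1 replaced by [Unit]. The first three clauses make [t'] fit for
    substitution; the last says that the theory computes the semantics on closed values. Both
    directions of wk-unit keep [t'], as [dom], [types] and [closing] ignore entries of type Q1. *)
Lemma clean G t s (d : typing G t s) : exists t',
  [/\ ceq G t t' s, forall Th, types Th G -> wt Th t' s, fv t' =1 dom G &
    forall n (g : env G) f, closing g f ->
      ceq (nseq n None) (subst f t') (quote (sem d g)) s].
Proof.
elim: d => {G t s}.
- move=> G x s h; case nt: (nontriv s).
    exists (Var x); split=> [|Th ty|i|n g f cl].
    + exact/ceq_refl/ty_var.
    + by constructor=> //; apply: ty => //; apply: nth_single.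
    + by rewrite (dom_single h).
    + by rewrite /= (closing_lookup h cl) //; apply: quote_ceq_refl.
  (* At type Q1 the variable is provably equal to [Unit], which has no free variable. *)
  case: s nt h => // _ h; exists Unit; have [k eG] := single_cat h.
  have tyU : typing G Unit Q1.
    by rewrite eG; apply: ty_wk; rewrite -[None :: _]/(nseq k.+1 None) -nseqD;
       apply: ty_unit.
  split=> [|Th _|i|n g f cl].
  + by apply/ceq_sym/ceq_ax => //; [apply: eq_eta_unit|apply: ty_var].
  + by constructor.
  + by rewrite eG dom_unit -[None :: _]/(nseq k.+1 None) -nseqD dom_nseq.
  + exact: (@quote_ceq_refl n Q1 tt).
- move=> k; exists Unit; split=> [|Th _|i|n g f cl].
  + exact/ceq_refl/ty_unit.
  + by constructor.
  + by rewrite dom_nseq.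
  + exact: (@quote_ceq_refl n Q1 tt).
- move=> k; exists Ff; split=> [|Th _|i|n g f cl].
  + exact/ceq_refl/ty_ff.
  + by constructor.
  + by rewrite dom_nseq.
  + exact: (@quote_ceq_refl n Q2 false).
- move=> k; exists Tt; split=> [|Th _|i|n g f cl].
  + exact/ceq_refl/ty_tt.
  + by constructor.
  + by rewrite dom_nseq.
  + exact: (@quote_ceq_refl n Q2 true).
- move=> G D T s s' t u m dt [t' [et wt' ft it]] du [u' [eu wu' fu iu]].
  exists (Let PVar t' u'); split=> [|Th ty|i|n g f cl].
  + exact: ceq_let m et eu.
  + have [tyG tyD] := merge_types m ty.
    apply: (wt_let (s := s)); [exact: wt'| |by rewrite fu].
    by apply: wu'; apply: types_cons.
  + by rewrite /= (merge_dom m) /= ft fu.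
  + have [Th ty] := types_exists D.
    have /= := merge_closing m cl; case: (delta m g) => gG gD [clG clD].
    have [mn] := merge_nseq n.
    have h1 := it n _ _ clG.
    (* The closing substitution for the body sends the bound variable to the value of the bound
       term. *)
    have /= h2 := iu n (gD, sem dt gG) (scons (quote (sem dt gG)) f)
      (conj (fun=> erefl) clD).
    apply: (ceq_step (ceq_let mn h1 _) (eq_beta _ _ (value_quote _))).
      apply: (@subst_ups_ceq_refl Th); [exact/wu'/types_cons|by rewrite fu|].
      move=> i; rewrite fu /dom /=; case E: (nth _ _ _) => [a|//] nt.
      by rewrite (ty _ _ E nt); apply: closing_val clD E nt.
    by rewrite subst1_ups.
- move=> G D T s s' t u m dt [t' [et wt' ft it]] du [u' [eu wu' fu iu]].
  exists (Pair t' u'); split=> [|Th ty|i|n g f cl].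
  + exact: ceq_pair m et eu.
  + by have [tyG tyD] := merge_types m ty; constructor; [apply: wt'|apply: wu'].
  + by rewrite /= (merge_dom m) /= ft fu.
  + have /= := merge_closing m cl; case: (delta m g) => gG gD [clG clD] /=.
    by have [mn] := merge_nseq n; apply: (ceq_pair mn); [apply: it|apply: iu].
- move=> G D T s s' r t u m dt [t' [et wt' ft it]] du [u' [eu wu' fu iu]].
  exists (Let PPair t' u'); split=> [|Th ty|i|n g f cl].
  + exact: ceq_letpair m et eu.
  + have [tyG tyD] := merge_types m ty.
    apply: (wt_letpair (s := s) (s' := s')); rewrite ?fu //; first exact: wt'.
    by apply: wu'; do 2!apply: types_cons.
  + by rewrite /= (merge_dom m) /= ft fu.
  + have [Th ty] := types_exists D.
    have /= := merge_closing m cl; case: (delta m g) => gG gD [clG clD].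
    have [mn] := merge_nseq n.
    have := it n _ _ clG; case: (sem dt gG) => a b /= h1.
    have /= h2 := iu n (gD, a, b) (scons (quote b) (scons (quote a) f))
      (conj (fun=> erefl) (conj (fun=> erefl) clD)).
    apply: (ceq_step (ceq_letpair mn h1 _)
      (eq_beta_pair _ _ (value_quote _) (value_quote _))).
      apply: (@subst_ups2_ceq_refl Th); rewrite ?fu //.
        by apply: wu'; do 2!apply: types_cons.
      move=> i; rewrite fu /dom /=; case E: (nth _ _ _) => [c|//] nt.
      by rewrite (ty _ _ E nt); apply: closing_val clD E nt.
    by rewrite subst2_ups.
- move=> G D T s c t u m dc [c' [ec wc' fc ic]] dt [t' [et wt' ft it]]
    du [u' [eu wu' fu iu]].
  exists (If c' t' u'); split=> [|Th ty|i|n g f cl].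
  + exact: ceq_if m ec et eu.
  + have [tyG tyD] := merge_types m ty.
    by constructor; [apply: wc'|apply: wt'|apply: wu'|move=> i; rewrite ft fu].
  + by rewrite /= (merge_dom m) /= fc ft fu orbb.
  + have /= := merge_closing m cl; case: (delta m g) => gG gD [clG clD] /=.
    have [mn] := merge_nseq n.
    have ht := it n _ _ clD; have hu := iu n _ _ clD.
    (* The condition is provably equal to a boolean constant, and the equation for that constant
       selects the branch. *)
    have := ic n _ _ clG; case: (sem dc gG) => /= hc.
      apply: (ceq_step (ceq_if mn hc (ceq_reflL ht) (ceq_reflL hu)) _ ht).
      exact: eq_if_tt.
    apply: (ceq_step (ceq_if mn hc (ceq_reflL ht) (ceq_reflL hu)) _ hu).
    exact: eq_if_ff.
- move=> G1 G2 t s d [t' [et wt' ft it]]; exists t'.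
  split=> [|Th ty|i|n g f cl].
  + exact: ceq_unwk.
  + by apply: wt' => i a /nth_unit E nt; apply: ty => //; apply: E.
  + by rewrite ft dom_unit.
  + exact/it/closing_add.
- move=> G1 G2 t s d [t' [et wt' ft it]]; exists t'.
  split=> [|Th ty|i|n g f cl].
  + exact: ceq_wk.
  + by apply: wt' => i a E nt; apply: ty => //; apply/nth_unit.
  + by rewrite ft dom_unit.
  + exact/it/closing_drop.
Qed.

(** * Expanding a term at one of its variables *)

Definition abstr (k x : nat) : term -> term :=
  rename (fun i => if i == x then 0 else i + k).

Definition repl (v : term) (x : nat) : term -> term :=
  subst (fun i => if i == x then v else Var i).

Lemma subst1_abstr v x t : subst1 v (abstr 1 x t) = repl v x t.
Proof.
rewrite /subst1 subst_rename; apply: eq_subst => i /=.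
by case: eqP; rewrite ?addn1.
Qed.

Lemma wt_abstr a Th t s x : wt Th t s -> Th x = a ->
  wt (scons a Th) (abstr 1 x t) s.
Proof.
move=> d ex; apply: wt_rename d _ => y _.
by case: eqP => [->|_]; rewrite ?addn1.
Qed.

Lemma fv_abstr0 k x t : 0 < k -> fv (abstr k x t) 0 = fv t x.
Proof.
move=> k0; apply/idP/idP=> [/fv_rename[j Hj]|Hx].
  case: eqP => [<- //|_ /eqP].
  by rewrite addn_eq0 -(negbK (k == 0)) -lt0n k0 andbF.
by apply/fv_rename; exists x; rewrite ?eqxx.
Qed.

Lemma fv_abstrS k x t i : fv (abstr k.+1 x t) (i + k.+1) = fv t i && (i != x).
Proof.
apply/idP/idP=> [/fv_rename[j Hj]|/andP[Hi /negPf nx]].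
  by case: eqP => [_|/eqP nx /addIn <-]; rewrite ?addnS // Hj.
by apply/fv_rename; exists i; rewrite ?nx.
Qed.

Lemma wt_repl Th t s v x : wt Th t s -> wt Th v (Th x) -> wt Th (repl v x t) s.
Proof.
move=> d dv; apply: wt_subst (d) _ => y Hy.
by case: eqP => [->//|_]; constructor=> //; apply: wt_fv Hy; apply: d.
Qed.

Lemma fv_repl v x t : fv v =1 pred0 ->
  fv (repl v x t) =1 (fun i => fv t i && (i != x)).
Proof.
move=> v0 i; apply/idP/idP=> [/fv_subst[j Hj]|/andP[Hi /negPf nx]].
  by case: eqP => [_|/eqP nx /= /eqP->]; rewrite ?v0 // Hj.
by apply/fv_subst; exists i; rewrite ?nx /=.
Qed.

Lemma wt_let_abstr Th t s x : wt Th t s -> fv t x ->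
  [/\ wt Th (Let PVar (Var x) (abstr 1 x t)) s &
      fv (Let PVar (Var x) (abstr 1 x t)) =1 fv t].
Proof.
move=> d Hx; have nt := wt_fv d Hx; split=> [|i /=].
  apply: (wt_let (s := Th x)); [by constructor|exact: wt_abstr|].
  by rewrite fv_abstr0 // Hx.
rewrite addnC fv_abstrS; case: eqP => [->|_]; by rewrite ?andbT // Hx.
Qed.

(** The beta equation read backwards, with the variable [x] itself as the value: replacing [x] by
    [x] changes nothing. *)
Lemma let_abstr_ceq Th n t s x : wt Th t s ->
  (forall i, fv t i -> i < n) -> fv t x ->
  ceq (mkctx Th n (fv t)) t (Let PVar (Var x) (abstr 1 x t)) s.
Proof.
move=> d le Hx; have [dl fl] := wt_let_abstr d Hx.
apply/ceq_sym/wt_ceq => //.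
rewrite -{2}(@subst_id Var t) //.
rewrite -(@eq_subst (fun i => if i == x then Var x else Var i)).
  by rewrite -/(repl _ _ _) -subst1_abstr; constructor; constructor.
by move=> i; case: eqP => [->|].
Qed.

Lemma split_merge Th n (A : pred nat) x : A x ->
  inhabited (Defs.merge (mkctx Th n (pred1 x))
    (mkctx Th n (fun i => A i && (i != x))) (mkctx Th n A)).
Proof.
move=> Ax; apply: mkctx_merge => i _ /=.
by case: eqP => [->|_]; rewrite ?andbT.
Qed.

(** Start from let x = x in t, expand the bound term by eta to if x then true else false, commute
    the let with the conditional, and contract each branch by beta. *)
Lemma split_if Th n t s x : wt Th t s -> (forall i, fv t i -> i < n) ->
  fv t x -> Th x = Q2 ->
  ceq (mkctx Th n (fv t)) t (If (Var x) (repl Tt x t) (repl Ff x t)) s.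
Proof.
move=> d le Hx ex; have lx := le _ Hx.
have le1 i : pred1 x i -> i < n by move=> /eqP->.
have leD i : fv t i && (i != x) -> i < n by move=> /andP[/le].
have dE : wt (scons Q2 Th) (abstr 1 x t) s by apply: wt_abstr.
have fE i : fv (abstr 1 x t) i.+1 = fv t i && (i != x).
  by rewrite -[i.+1]addn1 fv_abstrS.
have E0 : fv (abstr 1 x t) 0 by rewrite fv_abstr0.
have dx : wt Th (Var x) Q2 by constructor.
have dv v : wt Th v Q2 -> fv v =1 pred0 ->
    wt Th (Let PVar v (abstr 1 x t)) s /\
    fv (Let PVar v (abstr 1 x t)) =1 (fun i => fv t i && (i != x)).
  move=> dv v0; split=> [|i /=]; first by apply: (wt_let (s := Q2)).
  by rewrite v0 add1n fE.
have [dT fT] := dv Tt (wt_tt _) (fun=> erefl).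
have [dF fF] := dv Ff (wt_ff _) (fun=> erefl).
have [m] := split_merge Th n Hx.
apply: (ceq_trans (let_abstr_ceq d le Hx)).
have h1 : ceq (mkctx Th n (fv t)) (Let PVar (Var x) (abstr 1 x t))
    (Let PVar (If (Var x) Tt Ff) (abstr 1 x t)) s.
  apply: (ceq_let m (s := Q2)).
    apply/ceq_sym/wt_ceq => //; [exact: eq_eta_if|by constructor; constructor|].
    by move=> i /=; rewrite orbF.
  have -> : mkctx Th n (fun i => fv t i && (i != x)) =
      mkctx Th n (fv (abstr 1 x t) \o succn).
    by apply: eq_mkctx => i _; rewrite /= fE.
  apply: ceq_binder => //; apply: wt_ceq_refl => // -[|i] //.
  by rewrite fE => /leD.
apply: (ceq_step h1 (eq_let_if _ _ _ _ _ _)).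
apply: (ceq_if m); first exact: wt_ceq_refl.
- apply: wt_ceq => //.
    by rewrite -subst1_abstr; apply: eq_beta; constructor.
    by apply: wt_repl => //; rewrite ex; constructor.
  exact: fv_repl.
- apply: wt_ceq => //.
    by rewrite -subst1_abstr; apply: eq_beta; constructor.
    by apply: wt_repl => //; rewrite ex; constructor.
  exact: fv_repl.
Qed.

(* The components of a split pair must again avoid variables of type Q1. *)
Definition tidy (s : ty) (x : nat) : term := if nontriv s then Var x else Unit.

Lemma fv_tidy s x i : fv (tidy s x) i = nontriv s && (i == x).
Proof. by rewrite /tidy; case: nontriv. Qed.

Lemma wt_tidy Th x s : Th x = s -> wt Th (tidy s x) s.
Proof.
rewrite /tidy; case nt: nontriv => ex; first by constructor.
by case: s nt {ex} => //; constructor.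
Qed.

Lemma value_tidy s x : value (tidy s x).
Proof. by rewrite /tidy; case: nontriv; constructor. Qed.

(** At type Q1 the context has no entry for [x]; wk-unit introduces one, so that both sides are
    typable and the eta equation for [Unit] applies. *)
Lemma tidy_ceq Th n x s : Th x = s -> x < n ->
  ceq (mkctx Th n (fv (tidy s x))) (Var x) (tidy s x) s.
Proof.
move=> ex lx; case nt: (nontriv s).
  rewrite /tidy nt; apply: wt_ceq_refl => //; first by constructor.
  by move=> i /eqP->.
rewrite mkctx_none => [|i _]; last by rewrite fv_tidy nt.
case: s nt {ex} => // _.
have hs k : single (nseq x None ++ Some Q1 :: nseq k None) x Q1.
  by elim: (x) => [|y IH] /=; constructor.
rewrite -(subnKC lx) addSn -addnS nseqD /=.
apply/ceq_unwk/ceq_sym/ceq_ax; first exact: eq_eta_unit.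
  by apply/ty_wk; rewrite -[None :: _]/(nseq _.+1 None) -nseqD; apply: ty_unit.
exact/ty_var.
Qed.

(** The term t[(y, z)/x] under a pattern (y, z), with [Unit] for a component of type Q1 so that the
    result is clean again. *)
Definition split_body (a b : ty) (x : nat) : term -> term :=
  subst (fun i => if i == x then Pair (tidy a 1) (tidy b 0) else Var i.+2).

Section SplitPair.

Variables (Th : nat -> ty) (a b s : ty) (x : nat) (t : term).
Hypotheses (d : wt Th t s) (Hx : fv t x) (ex : Th x = Tens a b).

Let Th2 := scons b (scons a Th).

Lemma wt_split_body : wt Th2 (split_body a b x t) s.
Proof.
apply: wt_subst (d) _ => y Hy; case: eqP => [->|_].
  by rewrite ex; constructor; apply: wt_tidy.
by constructor=> //; apply: wt_fv Hy; apply: d.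
Qed.

Lemma fv_split_body0 : fv (split_body a b x t) 0 = nontriv b.
Proof.
apply/idP/idP=> [/fv_subst[j _]|nt].
  by case: eqP => //= _; rewrite !fv_tidy andbF andbT.
by apply/fv_subst; exists x; rewrite ?eqxx //= !fv_tidy nt orbT.
Qed.

Lemma fv_split_body1 : fv (split_body a b x t) 1 = nontriv a.
Proof.
apply/idP/idP=> [/fv_subst[j _]|nt].
  by case: eqP => //= _; rewrite !fv_tidy andbF andbT orbF.
by apply/fv_subst; exists x; rewrite ?eqxx //= !fv_tidy nt.
Qed.

Lemma fv_split_bodyS i : fv (split_body a b x t) i.+2 = fv t i && (i != x).
Proof.
apply/idP/idP=> [/fv_subst[j Hj]|/andP[Hi /negPf nx]].
  case: eqP => [_|/eqP nx /= /eqP[->]]; last by rewrite Hj.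
  by rewrite /= !fv_tidy !andbF.
by apply/fv_subst; exists i; rewrite ?nx /=.
Qed.

Lemma mkctx_split_body n :
  mkctx Th n (fv (split_body a b x t) \o succn \o succn) =
  mkctx Th n (fun i => fv t i && (i != x)).
Proof. by apply: eq_mkctx => i _; apply: fv_split_bodyS. Qed.

(** Read from right to left on let x = x in t, the equation [eq_beta_fold] gives let (y, z) = x in
    let x = (y, z) in t; the inner pair is tidied and the inner let contracted. *)
Lemma split_pair n : (forall i, fv t i -> i < n) ->
  ceq (mkctx Th n (fv t)) t (Let PPair (Var x) (split_body a b x t)) s.
Proof.
move=> le; have lx := le _ Hx.
have le1 i : pred1 x i -> i < n by move=> /eqP->.
have [m] := split_merge Th n Hx.
have dx : wt Th (Var x) (Tens a b) by constructor.
have hx : ceq (mkctx Th n (pred1 x)) (Var x) (Var x) (Tens a b).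
  exact: wt_ceq_refl.
(* Three indices are bound around [t]: the one that stands for [x] and the two of the pair
   pattern. *)
pose E := abstr 3 x t.
have dE : wt (scons (Tens a b) Th2) E s.
  by apply: wt_rename d _ => y _; case: eqP => [->|_]; rewrite ?addn3.
have E0 : fv E 0 by rewrite fv_abstr0.
have ES i : fv E i.+3 = fv t i && (i != x) by rewrite -[i.+3]addn3 fv_abstrS.
have E12 i : i < 2 -> fv E i.+1 = false.
  move=> i2; apply/negP=> /fv_rename[j _]; case: eqP => // _.
  by rewrite addn3; case: i i2 => [|[]].
pose B := fv (split_body a b x t).
have leB i : B i -> i < n.+2.
  by case: i => [|[|i]] //; rewrite /B fv_split_bodyS => /andP[/le].
have h2 : ceq (Some b :: Some a :: mkctx Th n (fun i => fv t i && (i != x)))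
    (Let PVar (Pair (Var 1) (Var 0)) E) (split_body a b x t) s.
  rewrite -mkctx_split_body; apply: ceq_binder2; last first.
  - have [|mp] := @mkctx_merge Th2 n.+2 (fv (tidy a 1)) (fv (tidy b 0))
      (fv (Pair (tidy a 1) (tidy b 0))); first by [].
    have [|mE] := @mkctx_merge Th2 n.+2 (fv (Pair (tidy a 1) (tidy b 0)))
      (fv E \o succn) B.
      by case=> [|[|i]] _; rewrite /B ?fv_split_body0 ?fv_split_body1
        ?fv_split_bodyS /= !fv_tidy ?ES ?E12 /= ?andbT ?andbF ?orbF /=.
    (* The components are tidied while the pair is still a bound term; the contracted body is then
       typed by [wt]. *)
    have h : ceq (mkctx Th2 n.+2 B) (Let PVar (Pair (Var 1) (Var 0)) E)
        (Let PVar (Pair (tidy a 1) (tidy b 0)) E) s.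
      apply: (ceq_let mE (s := Tens a b)).
        by apply: (ceq_pair mp); apply: tidy_ceq.
      apply: ceq_binder; first by rewrite E0.
      apply: wt_ceq_refl => // -[|[|[|i]]] //.
      by rewrite ES => /andP[/le].
    apply: (ceq_step h).
      by apply: eq_beta; constructor; apply: value_tidy.
    have -> : subst1 (Pair (tidy a 1) (tidy b 0)) E = split_body a b x t.
      rewrite /subst1 subst_rename; apply: eq_subst => i /=.
      by case: eqP; rewrite ?addn3.
    by apply: wt_ceq_refl => //; apply: wt_split_body.
  - exact: fv_split_body1.
  - exact: fv_split_body0.
apply: ceq_trans (ceq_letpair m hx h2).
(* With e := let z' = z in t[z'/x], the folded pair stays outside t, so that
   congruence can tidy its components before they are substituted. *)
pose e := Let PVar (Var 0) (abstr 2 x t).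
have ef : fold_pair e = Let PVar (Pair (Var 1) (Var 0)) E.
  rewrite /fold_pair /= /E /abstr subst_rename; congr Let.
  rewrite -[rename _ t](@subst_id Var) // subst_rename; apply: eq_subst => i /=.
  by case: eqP; rewrite ?addn2 ?addn3.
have e1 : subst1 (Var x) e = Let PVar (Var x) (abstr 1 x t).
  rewrite /subst1 /= /abstr subst_rename; congr Let.
  rewrite -[rename _ t](@subst_id Var) // subst_rename; apply: eq_subst => i /=.
  by case: eqP; rewrite ?addn2 ?addn1.
apply: (ceq_trans (let_abstr_ceq d le Hx)); rewrite -ef -e1.
apply/ceq_sym/ceq_eqn; first by apply: eq_beta_fold; constructor.
  by rewrite ef; apply: (ceq_letpair m hx (ceq_reflL h2)).
by rewrite e1; apply/ceq_reflL/ceq_sym/let_abstr_ceq.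
Qed.

End SplitPair.

(** * Lifting agreement from closed instances to open terms *)

(** A tensor weighs one more than its components together, so that splitting a pair lowers the
    total. *)
Fixpoint tsize (s : ty) : nat :=
  if s is Tens s s' then (tsize s + tsize s').+1 else 1.

Definition msize (Th : nat -> ty) n (A : pred nat) : nat :=
  \sum_(i < n | A i) tsize (Th i).

Lemma msize_split Th n (A : pred nat) x : A x -> x < n ->
  msize Th n A = tsize (Th x) + msize Th n (fun i => A i && (i != x)).
Proof. by move=> Ax lx; rewrite /msize (bigD1 (Ordinal lx)). Qed.

Lemma eq_msize Th n A B : A =1 B -> msize Th n A = msize Th n B.
Proof. by move=> e; apply: eq_bigl => i; apply: e. Qed.

Lemma msize_scons s Th n A :
  msize (scons s Th) n.+1 A <= tsize s + msize Th n (A \o succn).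
Proof.
rewrite /msize big_mkcond big_ord_recl /= -big_mkcond leq_add2r.
by case: ifP.
Qed.

(** Strong induction on [msize]: the same free variable is expanded in both terms, and congruence
    reduces to their bodies or branches. The last hypothesis ranges over all [m] because splitting a
    pair enlarges the scope [n] by two names. *)
Lemma ground_complete Th n t u s :
  wt Th t s -> wt Th u s -> fv t =1 fv u -> (forall i, fv t i -> i < n) ->
  (forall m f, (forall x, fv t x -> exists a : ty_sem (Th x), f x = quote a) ->
     ceq (nseq m None) (subst f t) (subst f u) s) ->
  ceq (mkctx Th n (fv t)) t u s.
Proof.
have [k] := ubnP (msize Th n (fv t)).
elim: k => // k IH in Th n t u *; rewrite ltnS => lek dt du e le H.
have leu i : fv u i -> i < n by rewrite -e; apply: le.
have emk : mkctx Th n (fv u) = mkctx Th n (fv t) by apply: eq_mkctx => i _.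
case: (pickP (fun i : 'I_n => fv t i)) => [x Hx|none]; last first.
  (* Without free variables the identity substitution is closing, so the hypothesis applies to the
     terms themselves. *)
  rewrite mkctx_none => [|i li]; last exact: (none (Ordinal li)).
  rewrite -(@subst_id Var t) // -(@subst_id Var u) //; apply: H => y Hy.
  by have := none (Ordinal (le _ Hy)); rewrite /= Hy.
have lx := ltn_ord x; have Hxu : fv u x by rewrite -e.
have [m] := split_merge Th n Hx.
rewrite (msize_split Th Hx lx) in lek.
case ex: (Th x) (wt_fv dt Hx) => [||a b] // _.
- apply: (ceq_trans (split_if dt le Hx ex)); apply: ceq_sym.
  have := split_if du leu Hxu ex; rewrite emk => hu.
  apply: (ceq_trans hu); apply: ceq_sym.
  have hv (v : ty_sem Q2) :
      ceq (mkctx Th n (fun i => fv t i && (i != x :> nat)))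
      (repl (quote v) x t) (repl (quote v) x u) s.
    have v0 := fv_quote v.
    rewrite -(@eq_mkctx Th n (fv (repl (quote v) x t))) => [|i _]; last first.
      exact: fv_repl.
    apply: IH.
    + rewrite (eq_msize _ _ (fv_repl x t v0)).
      by apply: leq_trans lek; rewrite ex.
    + by apply: wt_repl => //; rewrite ex; apply: wt_quote.
    + by apply: wt_repl => //; rewrite ex; apply: wt_quote.
    + by move=> i; rewrite !fv_repl // e.
    + by move=> i; rewrite fv_repl // => /andP[/le].
    (* Composed with the replacement of [x] by [v], a closing substitution for the branch becomes
       one for [t]. *)
    + move=> j f cl; rewrite !subst_subst; apply: H => y Hy /=.
      case: eqP => [->|/eqP nx].
        by rewrite ex; exists v; apply: (@subst_quote f Q2 v).
      by apply: cl; rewrite fv_repl // Hy.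
  apply: (ceq_if m); [|exact: (hv true)|exact: (hv false)].
  by apply: wt_ceq_refl => [|//|i /eqP->] //; constructor.
- apply: (ceq_trans (split_pair dt Hx ex le)); apply: ceq_sym.
  have := split_pair du Hxu ex leu; rewrite emk => hu.
  apply: (ceq_trans hu); apply: ceq_sym.
  apply: (ceq_letpair m (s := a) (s' := b)).
    by apply: wt_ceq_refl => [|//|i /eqP->] //; constructor.
  rewrite -(mkctx_split_body Th a b x t n); apply: ceq_binder2.
  + exact: fv_split_body0.
  + exact: fv_split_body1.
  apply: IH.
  (* The components weigh one less than the pair. A component of type Q1 is counted although it does
     not occur, so this is only an upper bound. *)
  + apply: leq_ltn_trans (msize_scons _ _ _ _) _.
    apply: leq_ltn_trans (leq_add (leqnn _) (msize_scons _ _ _ _)) _.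
    rewrite (@eq_msize _ _ _ (fun i => fv t i && (i != x :> nat))); last first.
      by move=> i; apply: fv_split_bodyS.
    by apply: leq_trans lek; rewrite ex /= addnA (addnC (tsize b)).
  + exact: wt_split_body.
  + exact: wt_split_body.
  + by move=> [|[|i]];
      rewrite ?fv_split_body0 ?fv_split_body1 ?fv_split_bodyS // e.
  + by move=> [|[|i]] //; rewrite fv_split_bodyS => /andP[/le].
  + move=> j f cl; rewrite !subst_subst; apply: H => y Hy /=.
    case: eqP => [->|/eqP nx]; last first.
      by apply: (cl y.+2); rewrite fv_split_bodyS Hy.
    (* A component that does not occur has type Q1, where [Unit] is already the quotation of
       [tt]. *)
    have tv c z : (nontriv c -> exists v : ty_sem c, f z = quote v) ->
        exists v : ty_sem c, subst f (tidy c z) = quote v.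
      rewrite /tidy; case nt: (nontriv c); first by apply.
      move=> _.
      by case: c nt => // _; exists tt.
    have [|va ea] := tv a 1.
      by move=> nt; apply: (cl 1); rewrite fv_split_body1.
    have [|vb eb] := tv b 0.
      by move=> nt; apply: (cl 0); rewrite fv_split_body0.
    by rewrite ex; exists (va, vb); rewrite /= ea eb.
Qed.

(** * Completeness in the original context *)

(** Weakening restores, one position at a time, the Q1 entries that [mkctx] over [dom G] omits; the
    prefix [G1] holds the positions already treated. *)
Lemma ceq_add_units G1 G t u s :
  ceq (G1 ++ [seq if o is Some Q1 then None else o | o <- G]) t u s ->
  ceq (G1 ++ G) t u s.
Proof.
elim: G G1 => [|o G IH] G1 //=.
case: o => [[||a b]|] h; last 3 first.
1-3: by rewrite -cat_rcons; apply: IH; rewrite cat_rcons.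
by apply: ceq_wk; rewrite -cat_rcons; apply: IH; rewrite cat_rcons.
Qed.

Lemma mkctx_dom Th G : types Th G ->
  mkctx Th (size G) (dom G) = [seq if o is Some Q1 then None else o | o <- G].
Proof.
move=> ty; apply: (@eq_from_nth _ None); rewrite ?size_map ?size_iota //.
move=> i li; rewrite nth_mkseq // (nth_map None) // /dom.
case E: (nth _ _ _) => [s|] //; have := ty _ _ E.
by case: s {E} => // [->|a b ->].
Qed.

Theorem proposition5p1 (G : ctx) (s : ty) (t u : term)
    (dt : typing G t s) (du : typing G u s) :
  (forall g : env G, sem dt g = sem du g) -> ceq G t u s.
Proof.
move=> e.
have [t' [et wt' ft it]] := clean dt; have [u' [eu wu' fu iu]] := clean du.
(* It suffices to compare the clean forms. *)
apply: (ceq_trans et); apply: ceq_sym; apply: (ceq_trans eu); apply: ceq_sym.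
have [Th ty] := types_exists G.
apply: (@ceq_add_units [::]); rewrite -(mkctx_dom ty) /=.
rewrite -(@eq_mkctx Th _ (fv t')) => [|i _]; last exact: ft.
apply: ground_complete; [exact: wt'|exact: wu'|by move=> i; rewrite ft fu| |].
  (* Names past the end of [G] read as [None], hence lie outside [dom G]. *)
  by move=> i; rewrite ft /dom; case: ltnP => // lei; rewrite nth_default.
(* A closing substitution of the clean forms comes from an environment, in which both terms have the
   same value. *)
move=> n f cl; have [i a E nt|g clg] := @closing_exists G f.
  have := cl i; rewrite (ty _ _ E nt); apply.
  by rewrite ft /dom E.
by apply: (ceq_trans (it n g f clg)); rewrite e; apply: ceq_sym; apply: iu.
Qed.
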